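(* Let $A$ be a Banach algebra with $\Delta(A)\neq\emptyset$. Then the following assertions are equivalent. (a) $A$ is point amenable. (b) $\mathcal{Z}(A,\mathbb{C}_\varphi)=\{0\}$ for all $\varphi\in\Delta(A)$. (c) $\mathfrak{D}_{d,\varphi}=0$ for every $\varphi\in\Delta(A)$ and every continuous point derivation $d$ at $\varphi$ of $A$.
   Context: Let $A$ be a complex Banach algebra with dual $A^*$. $\Delta(A)$ is the set of all non-zero multiplicative linear functionals on $A$. For $\varphi\in\Delta(A)$, $\mathbb{C}_\varphi$ denotes $\mathbb{C}$ with the Banach $A$-bimodule structure $a\cdot\alpha=\alpha\cdot a=\varphi(a)\alpha$ ($a\in A$, $\alpha\in\mathbb{C}$), and $\mathcal{Z}(A,\mathbb{C}_\varphi)$ is the space of all continuous derivations from $A$ into $\mathbb{C}_\varphi$ (continuous linear $D$ with $D(ab)=D(a)\cdot b+a\cdot D(b)$ for all $a,b\in A$). A functional $d\in A^*$ is a continuous point derivation of $A$ at $\varphi$ if $d(ab)=d(a)\varphi(b)+\varphi(a)d(b)$ for all $a,b\in A$. $A$ is point amenable if, for every $\varphi\in\Delta(A)$, every continuous point derivation of $A$ at $\varphi$ is zero. For $F_1,F_2\in A^*$, $\mathfrak{D}_{F_1,F_2}:A\to A^*$ is the continuous linear operator $\langle\mathfrak{D}_{F_1,F_2}(a),b\rangle=F_1(a)F_2(b)$. *)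

(* Defs.v *)
From HB Require Import structures.
From mathcomp Require Import all_boot all_order all_algebra.
From mathcomp Require Import complex.
From mathcomp Require Import all_classical all_reals all_analysis.

Set Implicit Arguments.
Unset Strict Implicit.
Unset Printing Implicit Defensive.

Import Order.TTheory GRing.Theory Num.Theory.
Import numFieldNormedType.Exports.

Local Open Scope classical_set_scope.
Local Open Scope ring_scope.

(* Banach algebras need not be unital, hence no [algType] structure. *)
HB.mixin Record CompleteNormedModule_isBanachAlgebra (K : numFieldType) A
    of CompleteNormedModule K A := {
  amul : A -> A -> A;
  amulA : associative amul;
  amulDl : left_distributive amul +%R;
  amulDr : right_distributive amul +%R;
  amulZl : forall (k : K) (a b : A), amul (k *: a) b = k *: amul a b;
  amulZr : forall (k : K) (a b : A), amul a (k *: b) = k *: amul a b;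
  norm_amul_le : forall a b : A, `|amul a b| <= `|a| * `|b| }.

#[short(type="banachAlgType")]
HB.structure Definition BanachAlgebra (K : numFieldType) :=
  {A of CompleteNormedModule_isBanachAlgebra K A & CompleteNormedModule K A}.

Notation "a ** b" := (amul a b) (at level 40, left associativity) : ring_scope.

Record banachBimodule (K : numFieldType) (A : banachAlgType K) :=
  BanachBimodule {
  bimod_sort :> completeNormedModType K;
  lact : A -> bimod_sort -> bimod_sort;
  ract : bimod_sort -> A -> bimod_sort;
  lact_linearl : forall x, linear (lact^~ x);
  lact_linearr : forall a, linear (lact a);
  ract_linearl : forall a, linear (ract^~ a);
  ract_linearr : forall x, linear (ract x);
  lactA : forall a b x, lact (a ** b) x = lact a (lact b x);
  ractA : forall x a b, ract x (a ** b) = ract (ract x a) b;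
  lractA : forall a x b, ract (lact a x) b = lact a (ract x b);
  lact_bounded : exists M : K, forall a x, `|lact a x| <= M * `|a| * `|x|;
  ract_bounded : exists M : K, forall x a, `|ract x a| <= M * `|a| * `|x| }.

Definition derivations (K : numFieldType) (A : banachAlgType K)
    (X : banachBimodule A) : set (A -> X) :=
  [set D | [/\ linear D, continuous D &
    forall a b, D (a ** b) = ract (D a) b + lact a (D b)]].
Arguments derivations {K A} X.

Section dual.
Variables (K : numFieldType) (A : completeNormedModType K).

Definition dual_pred : {pred A -> K^o} :=
  fun f => `[< linear f /\ continuous f >].

Fact dual_pred_submod_closed : submod_closed dual_pred.
Proof.
split.
  apply/asboolP; split; first by move=> k a b; rewrite /= scaler0 addr0.
  exact: cst_continuous.
move=> k f g /asboolP[lf cf] /asboolP[lg cg]; apply/asboolP; split.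
  move=> c a b; rewrite !fctE lf lg !scalerDr !scalerA (mulrC k).
  by rewrite addrACA.
by move=> a; apply: continuousD; [apply: continuousZl_tmp; exact: cf|exact: cg].
Qed.

HB.instance Definition _ :=
  GRing.isSubmodClosed.Build K (A -> K^o) dual_pred dual_pred_submod_closed.

Record dual := Dual { dual_fun :> A -> K^o; _ : dual_fun \in dual_pred }.

HB.instance Definition _ := [isSub for dual_fun].
HB.instance Definition _ := [Choice of dual by <:].
HB.instance Definition _ := [SubChoice_isSubLmodule of dual by <:].

Lemma dual_linear (f : dual) : linear f.
Proof. by case: f => f /= /asboolP[]. Qed.

Lemma dual_continuous (f : dual) : continuous f.
Proof. by case: f => f /= /asboolP[]. Qed.

Definition dual_of (f : A -> K^o) (lf : linear f) (cf : continuous f) : dual :=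
  @Dual f (asboolT (conj lf cf)).

(* The operator <D_{F1,F2}(a), b> = F1 a * F2 b, from [A] to its dual. *)
Definition rank1 (F1 F2 : dual) : A -> dual := fun a => F1 a *: F2.

Lemma rank1E (F1 F2 : dual) a b : rank1 F1 F2 a b = F1 a * F2 b.
Proof. by []. Qed.

Lemma rank1_linear (F1 F2 : dual) : linear (rank1 F1 F2).
Proof. by move=> k a b; rewrite /rank1 dual_linear scalerDl scalerA. Qed.

End dual.

Section complex.
Variable R : realType.
Implicit Types x : R[i].

Lemma complex_norm_Im x : `|complex.Im x|%:C%C <= `|x|.
Proof.
have -> : `|x| = `|x * 'i%C|
  by rewrite normrM [`|'i%C|]normc_def /= expr0n expr1n add0r sqrtr1 mulr1.
rewrite (le_trans _ (normc_ge_Re _))//.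
by case: x => a b /=; rewrite mulr0 mulr1 sub0r normrN.
Qed.

Lemma complex_norm_le x : `|x| <= (`|complex.Re x| + `|complex.Im x|)%:C%C.
Proof.
rewrite normc_def lecR -[leRHS]ger0_norm ?addr_ge0// -sqrtr_sqr ler_wsqrtr//.
by rewrite sqrrD !real_normK ?num_real// lerD2r lerDl mulrn_wge0// mulr_ge0.
Qed.

Lemma complex_gt0E (e : R[i]) : 0 < e -> exists2 r : R, 0 < r & e = r%:C%C.
Proof.
by case: e => a b /andP[/= /eqP -> a0]; exists a.
Qed.

Lemma complex_complete (F : set_system R[i]^o) :
  ProperFilter F -> cauchy F -> cvg F.
Proof.
move=> FF /cauchyP Fc.
have ReB : {morph @complex.Re R : x y / x - y} by case=> ? ? [].
have ImB : {morph @complex.Im R : x y / x - y} by case=> ? ? [].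
have cvg1 (f : R[i] -> R) : (forall x, `|f x|%:C%C <= `|x|) ->
    {morph f : x y / x - y} -> cvg (f @ F).
  move=> fle fB; apply: cauchy_cvg; apply: cauchy_exP => e e0.
  have [|x Fx] := Fc e%:C%C; first by rewrite ltcR.
  exists (f x); rewrite /nbhs/=; apply: filterS Fx => y.
  rewrite /ball/= => xy; rewrite -fB -ltcR; exact: le_lt_trans xy.
have /cvg_ex[/= a Fa] : cvg (@complex.Re R @ F).
  by apply: cvg1; [exact: normc_ge_Re|].
have /cvg_ex[/= b Fb] : cvg (@complex.Im R @ F).
  by apply: cvg1; [exact: complex_norm_Im|].
apply/cvg_ex; exists (Complex a b); apply/cvgrPdist_lt => _ /complex_gt0E[e e0 ->].
near=> x; apply: le_lt_trans (complex_norm_le _) _.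
rewrite ltcR (splitr e); apply: ltrD.
- by rewrite ReB; near: x; apply: cvgr_dist_lt => //; rewrite divr_gt0.
- by rewrite ImB; near: x; apply: cvgr_dist_lt => //; rewrite divr_gt0.
Unshelve. all: by end_near. Qed.

(* Not declared canonical: [Complete] on [_^o] is already keyed on [realType]. *)
Definition complexC : completeNormedModType R[i] :=
  HB.pack_for (completeNormedModType R[i]) R[i]^o
    (Uniform_isComplete.Build R[i]^o complex_complete).

End complex.

Lemma linear_morphB (K : pzRingType) (U V : lmodType K) (f : U -> V) :
  linear f -> {morph f : x y / x - y}.
Proof.
by move=> lf x y; rewrite -[- y]scaleN1r addrC lf scaleN1r addrC.
Qed.

Section characters.
Variables (R : realType) (A : banachAlgType R[i]).

(* Continuity is not required: it is automatic, see [character_continuous]. *)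
Definition characters : set (A -> R[i]^o) :=
  [set phi | [/\ linear phi, forall a b, phi (a ** b) = phi a * phi b
                & phi <> 0]].

Lemma amul_fixpoint (b : A) : `|b| < 1 -> exists y, y = b + b ** y.
Proof.
move=> b1; pose f y := b + b ** y; pose s n := iter n f 0.
have bB : {morph amul b : x y / x - y}.
  by apply: linear_morphB => k x y; rewrite amulDr amulZr.
have fB x y : f x - f y = b ** (x - y).
  by rewrite /f opprD addrACA subrr add0r bB.
pose M := (1 - `|b|)^-1.
have M1 : 1 + `|b| * M = M.
  have nz : 1 - `|b| != 0 by rewrite gt_eqF// subr_gt0.
  rewrite -[1 in LHS](mulfV nz) -/M mulrBl mul1r subrK//.
have M0 : 0 <= M by rewrite invr_ge0 subr_ge0 ltW.
have sM n : `|s n| <= M.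
  elim: n => [|n IHn]; first by rewrite normr0.
  rewrite /s iterS -/(s n) -M1 (le_trans (ler_normD _ _))// lerD ?(ltW b1)//.
  by rewrite (le_trans (norm_amul_le _ _))// ler_wpM2l.
have sD m k : `|s (m + k)%N - s m| <= M * `|b| ^+ m.
  elim: m => [|m IHm]; first by rewrite subr0 mulr1 sM.
  rewrite addSn /s !iterS -/(s m) -/(s (m + k)%N) fB exprSr mulrA mulrC.
  by rewrite (le_trans (norm_amul_le _ _))// ler_wpM2l.
have small (e : R[i]) : 0 < e -> exists m, M * `|b| ^+ m < e.
  move=> /complex_gt0E[r r0 ->].
  have rC (x : R[i]) : 0 <= x -> exists2 t : R, 0 <= t & x = t%:C%C.
    by case: x => p q /andP[/= /eqP -> p0]; exists p.
  have [t t0 bt] := rC _ (normr_ge0 b); have [u u0 ->] := rC _ M0.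
  rewrite bt in b1 *.
  have t1 : `|t| < 1 by rewrite ger0_norm// -ltcR.
  have /cvgrPdist_lt/(_ _ r0)[m _ /(_ m (leqnn m))] := cvg_geometric u t1.
  rewrite /= sub0r normrN => umt; exists m.
  by rewrite -rmorphXn -rmorphM ltcR (le_lt_trans (ler_norm _)).
have /cauchy_cvg/cvg_ex[/= y sy] : cauchy (s @ \oo).
  apply: cauchy_exP => e /small[m me]; exists (s m), m => // n /= mn.
  rewrite -ball_normE /ball_/= distrC -(subnKC mn).
  exact: le_lt_trans (sD _ _) me.
exists y; apply: (@cvg_unique _ _ ((fun n => s n.+1) @ \oo)).
- exact: norm_hausdorff.
- by have := sy; rewrite -cvg_shiftS.
- apply/cvgrPdist_le => e e0; near=> n.
  rewrite /s iterS -/(s n) -/(f y) fB (le_trans (norm_amul_le _ _))//.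
  rewrite (@le_trans _ _ `|y - s n|)// ?ler_piMl// ?(ltW b1)//.
  by near: n; apply: cvgr_dist_le.
Unshelve. all: by end_near. Qed.

Lemma character_norm_le phi a : characters phi -> `|phi a| <= `|a|.
Proof.
move=> [lphi mphi _]; rewrite real_leNgt ?normr_real//; apply/negP => a_phi.
have phiZ k x : phi (k *: x) = k * phi x.
  have phi0 : phi 0 = 0 by rewrite -(subrr (0 : A)) (linear_morphB lphi) subrr.
  by rewrite -[k *: x]addr0 lphi phi0 addr0.
have c0 : phi a != 0 by rewrite -normr_gt0 (le_lt_trans _ a_phi).
have [|y yE] := @amul_fixpoint ((phi a)^-1 *: a).
  by rewrite normrZ normfV mulrC ltr_pdivrMr ?mul1r// normr_gt0.
have := congr1 phi yE; rewrite -[X in phi (X + _)]scale1r lphi mphi phiZ.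
rewrite mulVf// mul1r scale1r => /eqP; rewrite eq_sym -subr_eq0 addrK.
by rewrite oner_eq0.
Qed.

Lemma character_linear phi : characters phi -> linear phi.
Proof. by case. Qed.

Lemma character_continuous phi : characters phi -> continuous phi.
Proof.
move=> phiA x; apply/cvgrPdist_le => e e0; near=> y.
rewrite -(linear_morphB (character_linear phiA)).
rewrite (le_trans (character_norm_le _ phiA))//.
Unshelve. all: by end_near. Qed.

(* A character, seen in [A^*] thanks to its automatic continuity. *)
Definition character_dual phi (phiA : characters phi) : dual A :=
  dual_of (character_linear phiA) (character_continuous phiA).

Definition point_derivation (phi : A -> R[i]^o) (d : dual A) : Prop :=
  forall a b, d (a ** b) = d a * phi b + phi a * d b.

Definition point_amenable : Prop :=
  forall phi, characters phi -> forall d, point_derivation phi d -> d = 0.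

Section bimodule.
Variables (phi : A -> R[i]^o) (phiA : characters phi).

Definition cact (a : A) (x : complexC R) : complexC R := phi a * x.

Fact cact_linearl x : linear (cact^~ x).
Proof.
by move=> k a b; rewrite /cact (character_linear phiA) mulrDl -scalerAl.
Qed.

Fact cact_linearr a : linear (cact a).
Proof. by move=> k x y; rewrite /cact mulrDr -[phi a * (k *: x)]scalerAr. Qed.

Fact cact_bounded :
  exists M : R[i], forall a x, `|cact a x| <= M * `|a| * `|x|.
Proof.
exists 1 => a x; rewrite mul1r normrM ler_wpM2r//.
exact: character_norm_le.
Qed.

Fact cact_boundedr :
  exists M : R[i], forall x a, `|cact a x| <= M * `|a| * `|x|.
Proof. by have [M actM] := cact_bounded; exists M. Qed.

Fact cactA a b x : cact (a ** b) x = cact a (cact b x).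
Proof. by case: phiA => _ mphi _; rewrite /cact mphi -mulrA. Qed.

Fact cactAr x a b : cact (a ** b) x = cact b (cact a x).
Proof. by rewrite cactA /cact mulrCA. Qed.

Fact cactCA a x b : cact b (cact a x) = cact a (cact b x).
Proof. by rewrite /cact mulrCA. Qed.

(* The bimodule C_phi. *)
Definition character_bimodule : banachBimodule A :=
  @BanachBimodule _ A (complexC R) cact (fun x a => cact a x)
    cact_linearl cact_linearr cact_linearr cact_linearl
    cactA cactAr cactCA cact_bounded cact_boundedr.

End bimodule.
End characters.

Arguments characters {R} A.
Arguments point_amenable {R} A.
Arguments point_derivation {R A} phi d.

(* Main.v *)
Require Import Defs.
From mathcomp Require Import all_boot all_order all_algebra.
From mathcomp Require Import complex.
From mathcomp Require Import all_classical all_reals all_analysis.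
Import Order.TTheory GRing.Theory Num.Theory.
Import numFieldNormedType.Exports.
Local Open Scope classical_set_scope.
Local Open Scope ring_scope.

(** Over the one-dimensional bimodule attached to a character phi, the
derivation rule is the rule for point derivations at phi, so the continuous
derivations into that bimodule are exactly the continuous point derivations at
phi ([derivations_character_bimoduleE]).  This identifies the vanishing of all
such derivations with point amenability.  The operator attached to d and phi is
the rank-one tensor of d and phi; since phi is nonzero, the tensor vanishes only
if d does ([rank1_eq0]), so nothing is lost by testing d through that
operator. *)

Lemma dual_ext (K : numFieldType) (A : completeNormedModType K)
  (f g : dual A) : (f : A -> K^o) = g -> f = g.
Proof. by move=> fg; apply: val_inj. Qed.

(** Where [F1] is nonzero, the operator takes a nonzero multiple of [F2] as its
value, and this is a nonzero functional when [F2] is. *)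
Lemma rank1_eq0 (K : numFieldType) (A : completeNormedModType K)
  (F1 F2 : dual A) : F2 <> 0 -> rank1 F1 F2 = 0 <-> F1 = 0.
Proof.
move=> /eqP F2_neq0; split=> [F12_0|->]; last first.
  by apply/funext => a; rewrite /rank1 scale0r.
apply: dual_ext; apply/funext => a.
have /eqP : rank1 F1 F2 a = 0 by rewrite F12_0.
by rewrite scaler_eq0 (negPf F2_neq0) orbF => /eqP.
Qed.

Section character.
Variables (R : realType) (A : banachAlgType R[i]).
Variables (phi : A -> R[i]^o) (phiA : characters A phi).

Lemma character_dual_neq0 : character_dual phiA <> 0.
Proof.
move=> phi0; have [_ _ []] := phiA.
exact: (congr1 (@dual_fun _ A) phi0).
Qed.

(** The scalars commute, so the right action [D a . b] may be written with the
scalar [phi b] on either side; the two product rules differ only in this. *)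
Lemma derivations_character_bimoduleE :
  derivations (character_bimodule phiA) =
  [set (d : A -> R[i]^o) | d in point_derivation phi].
Proof.
apply/seteqP; split=> [D [D_lin D_cont DM]|_ [d dM <-]].
  exists (dual_of (D_lin : linear (D : A -> R[i]^o)) D_cont) => // a b.
  by rewrite [LHS]DM /= /cact [phi b * D a]mulrC.
split=> [||a b]; [exact: dual_linear|exact: dual_continuous|].
by rewrite dM /= /cact [phi b * d a]mulrC.
Qed.

Lemma derivations_character_bimodule_eq0 :
  derivations (character_bimodule phiA) = [set 0] <->
  forall d, point_derivation phi d -> d = 0.
Proof.
rewrite derivations_character_bimoduleE; split=> [Z0 d dM|d0].
  have : [set (d : A -> R[i]^o) | d in point_derivation phi] d by exists d.
  by rewrite Z0 => d_eq0; exact: dual_ext.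
apply/seteqP; split=> [_ [d /d0 -> <-]//|_ ->].
exists 0 => // a b.
by rewrite /= mul0r mulr0 addr0.
Qed.

End character.

Theorem corollary2p6 (R : realType) (A : banachAlgType R[i])
    (A_character : characters A !=set0) :
  [<-> point_amenable A;
       forall (phi : A -> R[i]^o) (phiA : characters A phi),
         derivations (character_bimodule phiA) = [set 0];
       forall (phi : A -> R[i]^o) (phiA : characters A phi) (d : dual A),
         point_derivation phi d -> rank1 d (character_dual phiA) = 0].
Proof.
tfae=> [amenA phi phiA|Z0 phi phiA d dM|D0 phi phiA d dM].
- by apply/derivations_character_bimodule_eq0; exact: amenA.
- apply/rank1_eq0; first exact: character_dual_neq0.
  by move/derivations_character_bimodule_eq0: (Z0 phi phiA); exact.
- exact: (rank1_eq0 _ _ _ _ (character_dual_neq0 _ _ _ phiA)).1 (D0 _ phiA d dM).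
Qed.
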